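(* $\mathbb{Q}^{ia}$, the initial algebra among the algebras over the signature $\Sigma_{iamd}$ that satisfy the equations $E_{iamd}$, is (up to isomorphism) the subalgebra of the $\Sigma_{iamd}$-reduct of $\mathbb{Q}_0^{i}$ (the inversive meadow of rational numbers) whose domain is the set of all positive rational numbers.
   Context: The signature $\Sigma_{iamd}$ of inversive arithmetical meadows has the constant $1$, the binary operators $+$ and $\cdot$, and the unary operator ${}^{-1}$ (no constant $0$ and no additive inverse). $E_{iamd}$ is the set of equations $(x+y)+z=x+(y+z)$, $x+y=y+x$, $(x\cdot y)\cdot z=x\cdot(y\cdot z)$, $x\cdot y=y\cdot x$, $x\cdot 1=x$, $x\cdot(y+z)=x\cdot y+x\cdot z$, $x\cdot x^{-1}=1$. $I(\Sigma,E)$ denotes the initial algebra (unique up to isomorphism) among the algebras over the signature $\Sigma$ that satisfy the equations $E$; thus $\mathbb{Q}^{ia}=I(\Sigma_{iamd},E_{iamd})$, the inversive arithmetical meadow of rational numbers. The signature $\Sigma_{imd}$ of inversive meadows has the constants $0,1$, the binary operators $+,\cdot$, and the unary operators $-$ and ${}^{-1}$. $E_{imd}$ consists of the axioms of a commutative ring with a multiplicative identity (namely $(x+y)+z=x+(y+z)$, $x+y=y+x$, $x+0=x$, $x+(-x)=0$, $(x\cdot y)\cdot z=x\cdot(y\cdot z)$, $x\cdot y=y\cdot x$, $x\cdot 1=x$, $x\cdot(y+z)=x\cdot y+x\cdot z$) together with $(x^{-1})^{-1}=x$ and $x\cdot(x\cdot x^{-1})=x$. The inversive meadow of rational numbers is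 $\mathbb{Q}_0^{i}=I(\Sigma_{imd},E_{imd}\cup\{(1+x^2+y^2)\cdot(1+x^2+y^2)^{-1}=1\})$; by earlier known work it is (isomorphic to) the field of rational numbers expanded with the total multiplicative inverse operation satisfying $0^{-1}=0$, and its elements are identified with rational numbers in this way. Here $p^0=1$ and $p^{n+1}=p^n\cdot p$ for natural number exponents. *)

(* Defs.v *)
From HB Require Import structures.
From mathcomp Require Import all_boot all_order all_algebra.
From mathcomp Require Import boolp.

Set Implicit Arguments.
Unset Strict Implicit.
Unset Printing Implicit Defensive.

Import Order.TTheory GRing.Theory Num.Theory.
Local Open Scope ring_scope.
Local Open Scope quotient_scope.

Record signature := Signature { op :> Type; arity : op -> nat }.

Record algebra (S : signature) := Algebra {
  carrier :> Type;
  interp : forall f : S, ('I_(arity f) -> carrier) -> carrier }.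
Arguments interp {S} A f a : rename.

Definition is_hom (S : signature) (A B : algebra S) (h : A -> B) : Prop :=
  forall (f : S) (a : 'I_(arity f) -> A),
    h (interp A f a) = interp B f (fun i => h (a i)).

Definition isomorphic (S : signature) (A B : algebra S) : Prop :=
  exists2 h : A -> B, is_hom h & bijective h.

Definition closed_under_ops (S : signature) (A : algebra S) (D : pred A) : Prop :=
  forall (f : S) (a : 'I_(arity f) -> A), (forall i, D (a i)) -> D (interp A f a).

Definition subalgebra (S : signature) (A : algebra S) (D : pred A)
    (cD : closed_under_ops D) : algebra S :=
  @Algebra S {x : A | D x} (fun f a =>
    exist _ (interp A f (fun i => sval (a i))) (cD f _ (fun i => svalP (a i)))).

Definition subsignature (S : signature) (O : Type) (incl : O -> S) : signature :=
  @Signature O (fun f => arity (incl f)).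

Definition reduct (S : signature) (O : Type) (incl : O -> S) (A : algebra S) :
    algebra (subsignature incl) :=
  @Algebra (subsignature incl) A (fun f a => interp A (incl f) a).

Inductive term (S : signature) (V : Type) : Type :=
  | Var of V
  | App (f : S) of ('I_(arity f) -> term S V).
Arguments Var {S V} _.
Arguments App {S V} f _.

HB.instance Definition _ (S : signature) (V : Type) := gen_eqMixin (term S V).
HB.instance Definition _ (S : signature) (V : Type) := gen_choiceMixin (term S V).

Fixpoint eval (S : signature) (V : Type) (A : algebra S) (v : V -> A)
    (t : term S V) : A :=
  match t with
  | Var x => v x
  | App f a => interp A f (fun i => eval v (a i))
  end.

Fixpoint subst (S : signature) (V W : Type) (s : V -> term S W)
    (t : term S V) : term S W :=
  match t with
  | Var x => s x
  | App f a => App f (fun i => subst s (a i))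
  end.

Definition equation (S : signature) : Type := (term S nat * term S nat)%type.

Definition satisfies (S : signature) (E : equation S -> Prop) (A : algebra S) : Prop :=
  forall e, E e -> forall v : nat -> A, eval v e.1 = eval v e.2.

Notation closed_term S := (term S void).

Inductive derivable (S : signature) (E : equation S -> Prop) :
    closed_term S -> closed_term S -> Prop :=
  | derivable_ax e (s : nat -> closed_term S) :
      E e -> derivable E (subst s e.1) (subst s e.2)
  | derivable_refl t : derivable E t t
  | derivable_sym t u : derivable E t u -> derivable E u t
  | derivable_trans t u w : derivable E t u -> derivable E u w -> derivable E t w
  | derivable_congr f (a b : 'I_(arity f) -> closed_term S) :
      (forall i, derivable E (a i) (b i)) -> derivable E (App f a) (App f b).

Definition derivableb (S : signature) (E : equation S -> Prop) :
  rel (closed_term S) := fun t u => `[< derivable E t u >].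

Lemma derivableb_refl S (E : equation S -> Prop) : reflexive (derivableb E).
Proof. by move=> t; apply/asboolP/derivable_refl. Qed.

Lemma derivableb_sym S (E : equation S -> Prop) : symmetric (derivableb E).
Proof. by move=> t u; apply/asboolP/asboolP; apply: derivable_sym. Qed.

Lemma derivableb_trans S (E : equation S -> Prop) : transitive (derivableb E).
Proof.
by move=> u t w /asboolP tu /asboolP uw; apply/asboolP/(derivable_trans tu uw).
Qed.

Canonical derivable_equiv (S : signature) (E : equation S -> Prop) :=
  EquivRel (derivableb E) (@derivableb_refl S E) (@derivableb_sym S E)
    (@derivableb_trans S E).

(* Closed terms modulo derivable equality; initiality is proved in
   [initial_algebra_satisfies], [initial_hom_is_hom], [initial_hom_unique]. *)
Definition initial_algebra (S : signature) (E : equation S -> Prop) : algebra S :=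
  @Algebra S {eq_quot derivable_equiv E}
    (fun f a => \pi_{eq_quot derivable_equiv E} (App f (fun i => repr (a i)))).

Definition closed_eval (S : signature) (A : algebra S) : closed_term S -> A :=
  eval (of_void A).

Definition initial_hom (S : signature) (E : equation S -> Prop) (A : algebra S)
    (x : initial_algebra E) : A :=
  closed_eval A (repr (x : {eq_quot derivable_equiv E})).

Lemma pi_derivable S (E : equation S -> Prop) (t u : closed_term S) :
  derivable E t u <->
  \pi_{eq_quot derivable_equiv E} t = \pi_{eq_quot derivable_equiv E} u.
Proof.
split=> [tu|/eqmodP]; last by move/asboolP.
by apply/eqmodP/asboolP.
Qed.

Lemma derivable_repr S (E : equation S -> Prop) (t : closed_term S) :
  derivable E (repr (\pi_{eq_quot derivable_equiv E} t)) t.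
Proof. by apply/pi_derivable; rewrite reprK. Qed.

Lemma eval_subst S V W (A : algebra S) (v : W -> A) (s : V -> term S W) t :
  eval v (subst s t) = eval (fun x => eval v (s x)) t.
Proof.
by elim: t => [//|f a IH] /=; apply: (congr1 (interp A f)); apply/funext => i; apply: IH.
Qed.

Lemma initial_interp S (E : equation S -> Prop) f (b : 'I_(arity f) -> closed_term S) :
  interp (initial_algebra E) f (fun i => \pi_{eq_quot derivable_equiv E} (b i)) =
  \pi_{eq_quot derivable_equiv E} (App f b).
Proof. by apply/pi_derivable/derivable_congr => i; apply: derivable_repr. Qed.

Lemma initial_eval S (E : equation S -> Prop) V (s : V -> closed_term S) t :
  eval (fun x => \pi_{eq_quot derivable_equiv E} (s x) : initial_algebra E) t =
  \pi_{eq_quot derivable_equiv E} (subst s t).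
Proof.
elim: t => [//|f a IH].
rewrite [subst _ _]/= -initial_interp [LHS]/=.
by apply: (congr1 (interp (initial_algebra E) f)); apply/funext => i; apply: IH.
Qed.

Lemma closed_eval_sound S (E : equation S -> Prop) (A : algebra S) t u :
  satisfies E A -> derivable E t u -> closed_eval A t = closed_eval A u.
Proof.
move=> EA; elim=> {t u} [e s Ee|//|t u _ ->//|t u w _ -> _ ->//|f a b _ IH].
  by rewrite /closed_eval !eval_subst; apply: EA.
by rewrite /closed_eval /=; apply: (congr1 (interp A f)); apply/funext.
Qed.

Lemma initial_algebra_satisfies S (E : equation S -> Prop) :
  satisfies E (initial_algebra E).
Proof.
move=> e Ee v.
have -> : v = fun x => \pi_{eq_quot derivable_equiv E} (repr (v x)).
  by apply/funext => x; rewrite reprK.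
by rewrite !initial_eval; apply/pi_derivable/derivable_ax.
Qed.

Lemma initial_hom_is_hom S (E : equation S -> Prop) (A : algebra S) :
  satisfies E A -> is_hom (@initial_hom S E A).
Proof.
move=> EA f a; rewrite /initial_hom /=.
exact: (closed_eval_sound EA (derivable_repr _ _)).
Qed.

Lemma initial_hom_unique S (E : equation S -> Prop) (A : algebra S)
    (h : initial_algebra E -> A) :
  satisfies E A -> is_hom h -> h =1 @initial_hom S E A.
Proof.
move=> EA hom_h x; rewrite /initial_hom.
have <- : \pi_{eq_quot derivable_equiv E} (repr x) = x by rewrite reprK.
rewrite (closed_eval_sound EA (derivable_repr _ _)).
elim: (repr x) => [[]|f a IH].
by rewrite -initial_interp hom_h /closed_eval /=; apply: (congr1 (interp A f)); apply/funext.
Qed.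

Inductive imd_op := imd_zero | imd_one | imd_add | imd_mul | imd_opp | imd_inv.

Definition imd_arity (f : imd_op) : nat :=
  match f with
  | imd_zero | imd_one => 0
  | imd_add | imd_mul => 2
  | imd_opp | imd_inv => 1
  end.

Definition Sigma_imd : signature := Signature imd_arity.

Inductive iamd_op := iamd_one | iamd_add | iamd_mul | iamd_inv.

Definition imd_of_iamd (f : iamd_op) : Sigma_imd :=
  match f with
  | iamd_one => imd_one
  | iamd_add => imd_add
  | iamd_mul => imd_mul
  | iamd_inv => imd_inv
  end.

Definition Sigma_iamd : signature := subsignature imd_of_iamd.

Section ImdEquations.
Local Notation T := (term Sigma_imd nat).

Definition imd0 : T := @App Sigma_imd nat imd_zero (tnth [tuple]).
Definition imd1 : T := @App Sigma_imd nat imd_one (tnth [tuple]).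
Definition imdD (t u : T) : T := @App Sigma_imd nat imd_add (tnth [tuple t; u]).
Definition imdM (t u : T) : T := @App Sigma_imd nat imd_mul (tnth [tuple t; u]).
Definition imdN (t : T) : T := @App Sigma_imd nat imd_opp (tnth [tuple t]).
Definition imdV (t : T) : T := @App Sigma_imd nat imd_inv (tnth [tuple t]).

Fixpoint imdX (t : T) (n : nat) : T :=
  if n is m.+1 then imdM (imdX t m) t else imd1.

Definition E_imd (e : equation Sigma_imd) : Prop :=
  let x : T := Var 0%N in let y : T := Var 1%N in let z : T := Var 2%N in
  e \in [::
    (imdD (imdD x y) z, imdD x (imdD y z));
    (imdD x y, imdD y x);
    (imdD x imd0, x);
    (imdD x (imdN x), imd0);
    (imdM (imdM x y) z, imdM x (imdM y z));
    (imdM x y, imdM y x);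
    (imdM x imd1, x);
    (imdM x (imdD y z), imdD (imdM x y) (imdM x z));
    (imdV (imdV x), x);
    (imdM x (imdM x (imdV x)), x)].

Definition E_Q0i (e : equation Sigma_imd) : Prop :=
  let x : T := Var 0%N in let y : T := Var 1%N in
  let p : T := imdD (imdD imd1 (imdX x 2)) (imdX y 2) in
  E_imd e \/ e = (imdM p (imdV p), imd1).
End ImdEquations.

Section IamdEquations.
Local Notation T := (term Sigma_iamd nat).

Definition iamd1 : T := @App Sigma_iamd nat iamd_one (tnth [tuple]).
Definition iamdD (t u : T) : T := @App Sigma_iamd nat iamd_add (tnth [tuple t; u]).
Definition iamdM (t u : T) : T := @App Sigma_iamd nat iamd_mul (tnth [tuple t; u]).
Definition iamdV (t : T) : T := @App Sigma_iamd nat iamd_inv (tnth [tuple t]).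

Definition E_iamd (e : equation Sigma_iamd) : Prop :=
  let x : T := Var 0%N in let y : T := Var 1%N in let z : T := Var 2%N in
  e \in [::
    (iamdD (iamdD x y) z, iamdD x (iamdD y z));
    (iamdD x y, iamdD y x);
    (iamdM (iamdM x y) z, iamdM x (iamdM y z));
    (iamdM x y, iamdM y x);
    (iamdM x iamd1, x);
    (iamdM x (iamdD y z), iamdD (iamdM x y) (iamdM x z));
    (iamdM x (iamdV x), iamd1)].
End IamdEquations.

Definition Qia : algebra Sigma_iamd := initial_algebra E_iamd.

Definition Q0i : algebra Sigma_imd := initial_algebra E_Q0i.

(* [rat] is a field with [0^-1 = 0]. *)
Definition rat_meadow : algebra Sigma_imd :=
  @Algebra Sigma_imd rat (fun f =>
    match f return ('I_(imd_arity f) -> rat) -> rat with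
    | imd_zero => fun=> 0
    | imd_one => fun=> 1
    | imd_add => fun a => a ord0 + a ord_max
    | imd_mul => fun a => a ord0 * a ord_max
    | imd_opp => fun a => - a ord0
    | imd_inv => fun a => (a ord0)^-1
    end).

Lemma rat_meadow_satisfies : satisfies E_Q0i rat_meadow.
Proof.
move=> e [|->] /=; last first.
  move=> v; rewrite !mul1r.
  rewrite divff // gt_eqF // -addrA ltr_wpDr ?addr_ge0 //; exact: sqr_ge0.
rewrite /E_imd !inE.
do ![case/orP] => /eqP-> v; rewrite /=;
  rewrite ?(addrA, mulrA, addr0, mulr1, subrr, mulrDr, invrK) //.
- exact: addrC.
- exact: mulrC.
- by have [->|n0] := eqVneq (v 0%N : rat) 0; rewrite ?mul0r // mulfK.
Qed.

(* By initiality this is the only homomorphism from [Q0i] to [rat_meadow]; it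
   is the isomorphism that identifies the elements of [Q0i] with rationals. *)
Definition rat_of : Q0i -> rat_meadow := @initial_hom Sigma_imd E_Q0i rat_meadow.

Definition Q0i_pos : pred (reduct imd_of_iamd Q0i) :=
  fun x => (0 : rat) < rat_of x.

Lemma Q0i_pos_closed : closed_under_ops Q0i_pos.
Proof.
move=> f a pos_a; rewrite /Q0i_pos.
have /(_ (imd_of_iamd f) a) E := initial_hom_is_hom rat_meadow_satisfies.
rewrite /rat_of [initial_hom _ _]E.
case: f a pos_a {E} => a pos_a //=.
- by apply: addr_gt0; apply: pos_a.
- by apply: mulr_gt0; apply: pos_a.
- by rewrite invr_gt0; apply: pos_a.
Qed.

(* Main.v *)
(* Any closed term over Sigma_iamd is provably a quotient m/n of positive
   numerals, and such quotients are equal as soon as their values in rat are: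
   hence Qia embeds in rat, with image the positive rationals.

   What remains is that [rat_of] is injective on Q0i. For a prime p, counting
   squares modulo p gives a, b with p | 1 + a^2 + b^2, so the equation
   (1 + x^2 + y^2) (1 + x^2 + y^2)^-1 = 1 makes p invertible. Thus all positive
   numerals are invertible in Q0i, every closed term is provably a fraction n/d
   with d > 0, and fractions with the same rational value coincide. *)
From HB Require Import structures.
From mathcomp Require Import all_boot all_order all_algebra.
From mathcomp Require Import boolp ring zify.
Require Import Defs.

Set Implicit Arguments.
Unset Strict Implicit.
Unset Printing Implicit Defensive.

Import Order.TTheory GRing.Theory Num.Theory.
Local Open Scope ring_scope.
Local Open Scope quotient_scope.

(** * Minus one as a sum of two squares modulo a prime *)

(** Pigeonhole in ['F_p]: for i, j at most p/2 the values i^2 are distinct, and so are the values -1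
    - j^2. These are 2(p/2 + 1) > p values in all, so some i^2 equals some -1 - j^2. *)
Lemma prime_dvd_1_add_two_squares (p : nat) :
  prime p -> exists a b, (p %| 1 + a ^ 2 + b ^ 2)%N.
Proof.
move=> pr_p; have charp := pchar_Fp pr_p.
pose sq (i : 'I_(p./2.+1)) : 'F_p := (i ^ 2)%:R.
have lt_inj (i j : 'I_(p./2.+1)) : (i < j)%N -> sq i <> sq j.
  move=> ij /eqP; rewrite eq_sym -subr_eq0 -natrB ?leq_sqr 1?ltnW //.
  (* Both factors j - i and j + i are positive and less than p, because i < j <= p/2. *)
  rewrite -(dvdn_pcharf charp) subn_sqr Euclid_dvdM //.
  by case/orP => /dvdn_leq; have := ltn_ord j; lia.
have sq_inj : injective sq.
  move=> i j eq_ij; apply/val_inj.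
  by case: (ltngtP i j) => // /lt_inj; rewrite eq_ij.
have [[i [j eq_ij]]|no_sol] := pselect (exists i j, sq i = - 1 - sq j).
  exists i, j; rewrite (dvdn_pcharf charp) !natrD -/(sq i) -/(sq j) eq_ij.
  by apply/eqP; ring.
pose f (u : 'I_(p./2.+1) + 'I_(p./2.+1)) : 'F_p :=
  match u with inl i => sq i | inr j => - 1 - sq j end.
have /leq_card : injective f.
  move=> [i|i] [j|j] /= eq_f.
  - by rewrite (sq_inj _ _ eq_f).
  - by case: no_sol; exists i, j.
  - by case: no_sol; exists j, i.
  - by move/addrI/oppr_inj/sq_inj: eq_f => ->.
by rewrite card_sum card_ord card_Fp //; lia.
Qed.

(** * Term evaluation and transport along homomorphisms *)

Lemma tnth_tuple2 (T : Type) (a : 'I_2 -> T) : tnth [tuple a ord0; a ord_max] = a.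
Proof.
apply/funext => i; rewrite (tnth_nth (a i)).
by case: i => [[|[|//]] lti] /=; congr (a _); apply/val_inj.
Qed.

Lemma tnth_tuple1 (T : Type) (a : 'I_1 -> T) : tnth [tuple a ord0] = a.
Proof. by apply/funext => i; rewrite (ord1 i). Qed.

Lemma tnth_tuple0 (T : Type) (a : 'I_0 -> T) : tnth [tuple] = a.
Proof. by apply/funext => -[]. Qed.

Lemma comp_tnth (T U : Type) n (h : T -> U) (t : n.-tuple T) :
  (fun i => h (tnth t i)) = tnth (map_tuple h t).
Proof. by apply/funext => i; rewrite tnth_map. Qed.

Section Hom.
Variables (S : signature) (A B : algebra S) (h : A -> B).
Hypothesis hom_h : is_hom h.

Lemma hom_eval V (v : V -> A) t : h (eval v t) = eval (h \o v) t.
Proof.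
elim: t => [//|f a IH] /=; rewrite hom_h; congr (interp B f).
by apply/funext => i; apply: IH.
Qed.

(** Only valuations in the image of [h] are tested, so [B] itself may violate [E], as [rat] does for
    x x^-1 = 1 at 0. *)
Lemma satisfies_inj E : injective h ->
  (forall e, E e -> forall v, eval (h \o v) e.1 = eval (h \o v) e.2) ->
  satisfies E A.
Proof. by move=> inj_h EB e Ee v; apply: inj_h; rewrite !hom_eval EB. Qed.

End Hom.

(** The identity is a homomorphism, hence by uniqueness it is [initial_hom], which evaluates a
    representative. *)
Lemma closed_eval_repr (S : signature) (E : equation S -> Prop)
  (x : initial_algebra E) : exists t, x = closed_eval (initial_algebra E) t.
Proof.
exists (repr (x : {eq_quot derivable_equiv E})).
exact: (@initial_hom_unique S E (initial_algebra E) id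
  (@initial_algebra_satisfies S E)).
Qed.

Lemma tnth_map2 (T U : Type) (h : T -> U) x y :
  tnth (map_tuple h [tuple x; y]) = tnth [tuple h x; h y].
Proof. by congr tnth; apply/val_inj. Qed.

Lemma tnth_map1 (T U : Type) (h : T -> U) x :
  tnth (map_tuple h [tuple x]) = tnth [tuple h x].
Proof. by congr tnth; apply/val_inj. Qed.

Lemma tnth_map0 (T U : Type) (h : T -> U) :
  tnth (map_tuple h [tuple]) = tnth [tuple].
Proof. by congr tnth; apply/val_inj. Qed.

Lemma eval_tnth (S : signature) (V : Type) (A : algebra S) (v : V -> A) (f : S)
    (a : (arity f).-tuple (term S V)) :
  eval v (App f (tnth a)) = interp A f (tnth (map_tuple (eval v) a)).
Proof. by rewrite /= comp_tnth. Qed.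

Definition env3 (T : Type) (x y z : T) (n : nat) : T :=
  match n with 0%N => x | 1%N => y | _ => z end.

(** * Fractions of positive numerals in arithmetical meadows *)

Section ArithmeticalMeadow.
Variable A : algebra Sigma_iamd.

Definition am_one : A := @interp Sigma_iamd A iamd_one (tnth [tuple]).
Definition am_add (x y : A) : A :=
  @interp Sigma_iamd A iamd_add (tnth [tuple x; y]).
Definition am_mul (x y : A) : A :=
  @interp Sigma_iamd A iamd_mul (tnth [tuple x; y]).
Definition am_inv (x : A) : A := @interp Sigma_iamd A iamd_inv (tnth [tuple x]).

Local Notation "1" := am_one.
Local Notation "x + y" := (am_add x y).
Local Notation "x * y" := (am_mul x y).
Local Notation "x ^-1" := (am_inv x).

Lemma eval_iamd1 v : eval v iamd1 = 1.
Proof. by rewrite (@eval_tnth Sigma_iamd) tnth_map0. Qed.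

Lemma eval_iamdD v t u : eval v (iamdD t u) = eval v t + eval v u.
Proof. by rewrite (@eval_tnth Sigma_iamd) tnth_map2. Qed.

Lemma eval_iamdM v t u : eval v (iamdM t u) = eval v t * eval v u.
Proof. by rewrite (@eval_tnth Sigma_iamd) tnth_map2. Qed.

Lemma eval_iamdV v t : eval v (iamdV t) = (eval v t)^-1.
Proof. by rewrite (@eval_tnth Sigma_iamd) tnth_map1. Qed.

(* [am_num n] is the numeral of [n.+1]: there is no zero. *)
Fixpoint am_num (n : nat) : A := if n is m.+1 then am_num m + 1 else 1.

Hypothesis EA : satisfies E_iamd A.

Lemma am_axioms x y z :
  [/\ (x + y) + z = x + (y + z), x + y = y + x, (x * y) * z = x * (y * z),
      x * y = y * x & [/\ x * 1 = x, x * (y + z) = x * y + x * z & x * x^-1 = 1]].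
Proof.
have := fun e Ee => EA Ee (env3 x y z) : eval _ e.1 = eval _ e.2.
rewrite /E_iamd.
by do 7! [case/forall_cons;
  rewrite !(eval_iamd1, eval_iamdD, eval_iamdM, eval_iamdV) => ?].
Qed.

Lemma am_addA x y z : x + (y + z) = x + y + z.
Proof. by have [-> _ _ _ _] := am_axioms x y z. Qed.

Lemma am_mulA x y z : x * (y * z) = x * y * z.
Proof. by have [_ _ -> _ _] := am_axioms x y z. Qed.

Lemma am_mulC x y : x * y = y * x.
Proof. by have [_ _ _ -> _] := am_axioms x y x. Qed.

Lemma am_mulr1 x : x * 1 = x.
Proof. by have [_ _ _ _ [-> _ _]] := am_axioms x x x. Qed.

Lemma am_mulDr x y z : x * (y + z) = x * y + x * z.
Proof. by have [_ _ _ _ [_ -> _]] := am_axioms x y z. Qed.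

Lemma am_mulDl x y z : (x + y) * z = x * z + y * z.
Proof. by rewrite !(am_mulC _ z) am_mulDr. Qed.

Lemma am_mulrV x : x * x^-1 = 1.
Proof. by have [_ _ _ _ [_ _ ->]] := am_axioms x x x. Qed.

Lemma am_mulrK x y : x * y * y^-1 = x.
Proof. by rewrite -am_mulA am_mulrV am_mulr1. Qed.

Lemma am_mulAC x y z : x * y * z = x * z * y.
Proof. by rewrite -!am_mulA (am_mulC y). Qed.

Lemma am_numD m n : am_num m + am_num n = am_num (m + n).+1.
Proof. by elim: n => [|n IH] /=; rewrite ?addn0 // am_addA IH addnS. Qed.

Lemma am_numM m n : am_num m * am_num n = am_num (m.+1 * n.+1).-1.
Proof.
elim: n => [|n IH]; first by rewrite am_mulr1 muln1.
by rewrite am_mulDr am_mulr1 IH am_numD; congr am_num; lia.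
Qed.

(** Induction on [t]: sums and products of fractions are again fractions, and inversion swaps
    numerator and denominator. *)
Lemma closed_am_fraction (t : closed_term Sigma_iamd) :
  exists m n, closed_eval A t * am_num n = am_num m.
Proof.
elim: t => [[]|f a IH].
pose b i := closed_eval A (a i).
have -> : closed_eval A (App f a) = interp A f b by [].
have {IH} : forall i, exists m n, b i * am_num n = am_num m := IH.
move: b; case: f {a} => b IH.
- by exists 0%N, 0%N; rewrite am_mulr1 -[b]tnth_tuple0.
- have [m [n xE]] := IH ord0; have [m' [n' yE]] := IH ord_max.
  rewrite -[b]tnth_tuple2 -/(am_add _ _).
  (* Since [am_num] is shifted by one, these indices encode the usual cross-multiplied numerator and
     the product of the denominators. *)
  exists ((m.+1 * n'.+1).-1 + (m'.+1 * n.+1).-1).+1%N, (n.+1 * n'.+1).-1%N.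
  rewrite -am_numD -!am_numM -xE -yE am_mulDl.
  by rewrite {2}[am_num n * _]am_mulC !am_mulA.
- have [m [n xE]] := IH ord0; have [m' [n' yE]] := IH ord_max.
  rewrite -[b]tnth_tuple2 -/(am_mul _ _).
  exists (m.+1 * m'.+1).-1%N, (n.+1 * n'.+1).-1%N.
  by rewrite -!am_numM -xE -yE am_mulA [RHS]am_mulA; congr (_ * _); rewrite am_mulAC.
- have [m [n xE]] := IH ord0.
  rewrite -[b]tnth_tuple1 -/(am_inv _).
  by exists n, m; rewrite -xE am_mulA [X in X * _]am_mulC am_mulrV am_mulC am_mulr1.
Qed.

Variable k : A -> reduct imd_of_iamd rat_meadow.
Hypothesis hom_k : is_hom k.

Lemma am_homD x y : k (x + y) = (k x + k y)%R.
Proof. by rewrite /am_add hom_k. Qed.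

Lemma am_homM x y : k (x * y) = (k x * k y)%R.
Proof. by rewrite /am_mul hom_k. Qed.

Lemma am_homV x : k x^-1 = ((k x)^-1)%R.
Proof. by rewrite /am_inv hom_k. Qed.

Lemma am_hom_num n : k (am_num n) = n.+1%:R.
Proof.
elim: n => [|n IH] /=; first by rewrite /am_one hom_k.
by rewrite am_homD IH /am_one hom_k -[in RHS]addn1 natrD.
Qed.

Lemma am_hom_surj (q : rat) : 0 < q -> exists x, k x = q.
Proof.
move=> q_gt0; exists (am_num `|numq q|.-1 * (am_num `|denq q|.-1)^-1).
rewrite am_homM am_homV !am_hom_num !prednK ?absz_gt0 ?numq_eq0 ?gt_eqF ?denq_gt0 //.
by rewrite !natr_absz !gtr0_norm ?numq_gt0 ?denq_gt0 // divq_num_den.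
Qed.

Hypothesis closedA : forall x : A, exists t, x = closed_eval A t.

(** Equal rational values of two fractions give an equality of cross products in [nat]; it carries
    over to numerals of [A], where the denominators cancel. *)
Lemma am_hom_inj : injective k.
Proof.
move=> x y kxy.
have [t xt] := closedA x; have [m [n]] := closed_am_fraction t; rewrite -xt => xE.
have [u yu] := closedA y; have [m' [n']] := closed_am_fraction u; rewrite -yu => yE.
have eq_mn : (m.+1 * n'.+1 = m'.+1 * n.+1)%N.
  apply/eqP; rewrite -(eqr_nat rat) !natrM -!am_hom_num -xE -yE !am_homM kxy.
  by rewrite mulrAC.
rewrite -(am_mulrK x (am_num n)) xE -(am_mulrK (am_num m) (am_num n')).
rewrite am_numM eq_mn -am_numM -yE.
by rewrite [y * _ * _]am_mulAC !am_mulrK.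
Qed.

End ArithmeticalMeadow.

(** * Inversive meadows as commutative rings *)

Section InversiveMeadow.
Variable A : algebra Sigma_imd.
Hypothesis EA : satisfies E_imd A.

Definition im_zero : A := @interp Sigma_imd A imd_zero (tnth [tuple]).
Definition im_one : A := @interp Sigma_imd A imd_one (tnth [tuple]).
Definition im_add (x y : A) : A := @interp Sigma_imd A imd_add (tnth [tuple x; y]).
Definition im_mul (x y : A) : A := @interp Sigma_imd A imd_mul (tnth [tuple x; y]).
Definition im_opp (x : A) : A := @interp Sigma_imd A imd_opp (tnth [tuple x]).
Definition im_inv (x : A) : A := @interp Sigma_imd A imd_inv (tnth [tuple x]).

Lemma eval_imd0 v : eval v imd0 = im_zero.
Proof. by rewrite (@eval_tnth Sigma_imd) tnth_map0. Qed.

Lemma eval_imd1 v : eval v imd1 = im_one.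
Proof. by rewrite (@eval_tnth Sigma_imd) tnth_map0. Qed.

Lemma eval_imdD v t u : eval v (imdD t u) = im_add (eval v t) (eval v u).
Proof. by rewrite (@eval_tnth Sigma_imd) tnth_map2. Qed.

Lemma eval_imdM v t u : eval v (imdM t u) = im_mul (eval v t) (eval v u).
Proof. by rewrite (@eval_tnth Sigma_imd) tnth_map2. Qed.

Lemma eval_imdN v t : eval v (imdN t) = im_opp (eval v t).
Proof. by rewrite (@eval_tnth Sigma_imd) tnth_map1. Qed.

Lemma eval_imdV v t : eval v (imdV t) = im_inv (eval v t).
Proof. by rewrite (@eval_tnth Sigma_imd) tnth_map1. Qed.

Definition eval_imdE :=
  (eval_imd0, eval_imd1, eval_imdD, eval_imdM, eval_imdN, eval_imdV).

Lemma im_axioms x y z :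
  [/\ im_add (im_add x y) z = im_add x (im_add y z), im_add x y = im_add y x,
      im_add x im_zero = x & im_add x (im_opp x) = im_zero] /\
  [/\ im_mul (im_mul x y) z = im_mul x (im_mul y z), im_mul x y = im_mul y x,
      im_mul x im_one = x &
      im_mul x (im_add y z) = im_add (im_mul x y) (im_mul x z)] /\
  im_inv (im_inv x) = x /\ im_mul x (im_mul x (im_inv x)) = x.
Proof.
have := fun e Ee => EA Ee (env3 x y z) : eval _ e.1 = eval _ e.2.
rewrite /E_imd.
by do 10! [case/forall_cons; rewrite !eval_imdE => ?].
Qed.

Lemma im_addA : associative im_add.
Proof. by move=> x y z; have [[-> _ _ _] _] := im_axioms x y z. Qed.

Lemma im_addC : commutative im_add.
Proof. by move=> x y; have [[_ -> _ _] _] := im_axioms x y x. Qed.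

Lemma im_add0r : left_id im_zero im_add.
Proof. by move=> x; rewrite im_addC; have [[_ _ -> _] _] := im_axioms x x x. Qed.

Lemma im_addNr : left_inverse im_zero im_opp im_add.
Proof. by move=> x; rewrite im_addC; have [[_ _ _ ->] _] := im_axioms x x x. Qed.

Lemma im_mulA : associative im_mul.
Proof. by move=> x y z; have [_ [[-> _ _ _] _]] := im_axioms x y z. Qed.

Lemma im_mulC : commutative im_mul.
Proof. by move=> x y; have [_ [[_ -> _ _] _]] := im_axioms x y x. Qed.

Lemma im_mul1r : left_id im_one im_mul.
Proof. by move=> x; rewrite im_mulC; have [_ [[_ _ -> _] _]] := im_axioms x x x. Qed.

Lemma im_mulDl : left_distributive im_mul im_add.
Proof.
move=> x y z; rewrite !(im_mulC _ z).
by have [_ [[_ _ _ ->] _]] := im_axioms z x y.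
Qed.

(* [EA] is kept in the type so that the ring instances below can be found. *)
Definition im_ring : Type := let _ := EA in A.

HB.instance Definition _ := gen_eqMixin im_ring.
HB.instance Definition _ := gen_choiceMixin im_ring.
HB.instance Definition _ :=
  GRing.isZmodule.Build im_ring im_addA im_addC im_add0r im_addNr.
HB.instance Definition _ :=
  GRing.Zmodule_isComPzRing.Build im_ring im_mulA im_mulC im_mul1r im_mulDl.

Definition im_ring_inv : im_ring -> im_ring := im_inv.
Local Notation inv := im_ring_inv.

Lemma im_invK : involutive inv.
Proof. by move=> x; have [_ [_ [E _]]] := im_axioms x x x. Qed.

Lemma im_mulVK (x : im_ring) : x * (x * inv x) = x.
Proof. by have [_ [_ [_ E]]] := im_axioms x x x. Qed.

(** Apply x (x x^-1) = x to x = 0^-1, whose inverse is 0. *)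
Lemma im_inv0 : inv 0 = 0.
Proof. by rewrite -{1}(im_mulVK (inv 0)) im_invK !mulr0. Qed.

(** Multiplying x (x x^-1) = x by y yields x x^-1 = 1, and inverses in a commutative ring are
    unique. *)
Lemma im_inv_unique (x y : im_ring) : x * y = 1 -> inv x = y.
Proof.
move=> xy1; have xVx : x * inv x = 1.
  by rewrite -[LHS]mulr1 -xy1 mulrA [_ * x]mulrC im_mulVK.
by rewrite -[LHS]mul1r -xy1 mulrAC xVx mul1r.
Qed.

Variable k : A -> rat_meadow.
Hypothesis hom_k : is_hom k.
Local Notation f := (k : im_ring -> rat).

Lemma im_homD x y : f (x + y) = f x + f y.
Proof. exact: hom_k. Qed.

Lemma im_homM x y : f (x * y) = f x * f y.
Proof. exact: hom_k. Qed.

Lemma im_homN x : f (- x) = - f x.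
Proof. exact: hom_k. Qed.

Lemma im_hom_nat n : f n%:R = n%:R.
Proof.
elim: n => [|n IH]; first exact: hom_k.
by rewrite mulrS [RHS]mulrS im_homD IH; congr (_ + _); apply: hom_k.
Qed.

Lemma im_hom_int (n : int) : f n%:~R = n%:~R.
Proof.
case: n => n; first exact: im_hom_nat.
by rewrite NegzE !mulrNz im_homN; congr (- _); apply: im_hom_nat.
Qed.

End InversiveMeadow.

(** * Invertible numerals and fractions under the two-squares equation *)

Section TwoSquaresMeadow.
Variable A : algebra Sigma_imd.
Hypothesis EA : satisfies E_Q0i A.

Lemma satisfies_E_imd : satisfies E_imd A.
Proof. by move=> e Ee; apply: EA; left. Qed.

Local Notation R := (im_ring satisfies_E_imd).
Local Notation inv := (@im_ring_inv A satisfies_E_imd).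

Lemma two_squares_invertible (a b : R) :
  (1 + a ^+ 2 + b ^+ 2) * inv (1 + a ^+ 2 + b ^+ 2) = 1.
Proof.
have E := EA (or_intror erefl) (env3 a b b); rewrite !eval_imdE in E.
(* The factors 1 arise because [imdX] starts its powers at [imd1]. *)
have {}E : (1 + 1 * a * a + 1 * b * b) * inv (1 + 1 * a * a + 1 * b * b) = 1 := E.
by rewrite !mul1r in E.
Qed.

(** Strong induction: the least prime factor p of n divides some invertible 1 + a^2 + b^2, so p is
    invertible, and n/p is invertible by induction. *)
Lemma natr_invertible (n : nat) : (0 < n)%N -> exists y : R, n%:R * y = 1.
Proof.
elim/ltn_ind: n => n IH n_gt0.
have [n_le1|n_gt1] := leqP n 1.
  by exists 1; rewrite (_ : n = 1%N) ?mul1r //; lia.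
have pr_p := pdiv_prime n_gt1; have p_gt1 := prime_gt1 pr_p.
have [a [b /dvdnP[c sumE]]] := prime_dvd_1_add_two_squares pr_p.
have := two_squares_invertible a%:R b%:R.
have -> : 1 + a%:R ^+ 2 + b%:R ^+ 2 = (1 + a ^ 2 + b ^ 2)%:R :> R.
  by rewrite !natrD !natrX.
rewrite sumE natrM; set s := inv _ => cps.
have [y yE] : exists y : R, (n %/ pdiv n)%:R * y = 1.
  by apply: IH; rewrite ?ltn_Pdiv ?divn_gt0 ?pdiv_leq //; lia.
exists (y * (c%:R * s)); rewrite -(divnK (pdiv_dvd n)) natrM.
transitivity ((n %/ pdiv n)%:R * y * (c%:R * (pdiv n)%:R * s)); first by ring.
by rewrite yE cps mulr1.
Qed.

Lemma closed_im_fraction (t : closed_term Sigma_imd) :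
  exists (n : int) (d : nat),
    (0 < d)%N /\ (closed_eval A t : R) * d%:R = n%:~R.
Proof.
elim: t => [[]|f a IH].
pose c i : R := closed_eval A (a i).
have -> : closed_eval A (App f a) = interp A f c by [].
have {IH} : forall i, exists (n : int) (d : nat),
  (0 < d)%N /\ c i * d%:R = n%:~R := IH.
move: c; case: f {a} => c IH.
- by exists 0, 1%N; rewrite -[c]tnth_tuple0 mulr1.
- by exists 1, 1%N; rewrite -[c]tnth_tuple0 mulr1.
- have [n [d [d0 xE]]] := IH ord0; have [n' [d' [d0' yE]]] := IH ord_max.
  rewrite -[c]tnth_tuple2 -[interp _ _ _]/(c ord0 + c ord_max).
  exists (n * d' + n' * d), (d * d')%N; rewrite muln_gt0 d0 d0'; split=> //.
  by rewrite intrD !intrM -xE -yE -!pmulrn natrM; ring.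
- have [n [d [d0 xE]]] := IH ord0; have [n' [d' [d0' yE]]] := IH ord_max.
  rewrite -[c]tnth_tuple2 -[interp _ _ _]/(c ord0 * c ord_max).
  exists (n * n'), (d * d')%N; rewrite muln_gt0 d0 d0'; split=> //.
  by rewrite !intrM -xE -yE natrM; ring.
- have [n [d [d0 xE]]] := IH ord0.
  rewrite -[c]tnth_tuple1 -[interp _ _ _]/(- c ord0).
  by exists (- n), d; rewrite mulrNz -xE mulNr.
- have [n [d [d0 xE]]] := IH ord0.
  rewrite -[c]tnth_tuple1 -[interp _ _ _]/(inv (c ord0)).
  have [dV dVE] := natr_invertible d0.
  have {xE} xE : c ord0 = n%:~R * dV by rewrite -xE -mulrA dVE mulr1.
  (* A zero numerator cannot become a denominator; here 0^-1 = 0 applies. *)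
  have [n0|n_neq0] := eqVneq n 0.
    by exists 0, 1%N; rewrite xE n0 mul0r im_inv0 mul0r.
  (* The sign is split off so that the new denominator m = |n| is positive; the sign is its own
     inverse and moves to the numerator. *)
  have [m m0 [s nE]] : exists2 m, (0 < m)%N & exists s : bool, n = (-1) ^+ s * m%:Z.
    by exists `|n|%N; rewrite ?absz_gt0 //; exists (n < 0); rewrite -intEsign.
  have [mV mVE] := natr_invertible m0.
  exists ((-1) ^+ s * d%:Z), m; split => //.
  have -> : inv (c ord0) = (-1) ^+ s * mV * d%:R.
    apply: im_inv_unique; rewrite xE nE intrM rmorph_sign -pmulrn.
    have s2 : (-1) ^+ s * (-1) ^+ s = 1 :> R by rewrite -expr2 sqrr_sign.
    transitivity ((-1) ^+ s * (-1) ^+ s * (m%:R * mV) * (d%:R * dV)).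
      by ring.
    by rewrite s2 mVE dVE !mulr1.
  transitivity ((-1) ^+ s * d%:R * (m%:R * mV)); first by ring.
  by rewrite mVE mulr1 intrM rmorph_sign.
Qed.

Variable k : A -> rat_meadow.
Hypothesis hom_k : is_hom k.
Hypothesis closedA : forall x : A, exists t, x = closed_eval A t.

(** Cross multiplication as for arithmetical meadows, with integer numerators and with denominators
    cancelled by [natr_invertible]. *)
Lemma im_hom_inj : injective k.
Proof.
move=> x y kxy; have [t xt] := closedA x; have [u yu] := closedA y.
have [n [d [d0]]] := closed_im_fraction t; rewrite -xt => xE.
have [n' [d' [d0']]] := closed_im_fraction u; rewrite -yu => yE.
have eq_nd : n * d' = n' * d.
  have homE := im_hom_int satisfies_E_imd hom_k.
  apply/eqP; rewrite -(eqr_int rat) !intrM -(homE n) -(homE n') -xE -yE.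
  by rewrite !(im_homM hom_k) !(im_hom_nat _ hom_k) kxy mulrAC.
have [e eE] := natr_invertible d0; have [e' eE'] := natr_invertible d0'.
suff : x = y :> R by [].
have -> : x = (x : R) * (d%:R * e) * (d'%:R * e') :> R by rewrite eE eE' !mulr1.
transitivity ((n * d')%:~R * e * e'); first by rewrite intrM -xE -pmulrn; ring.
rewrite eq_nd intrM -yE -pmulrn.
transitivity ((y : R) * (d%:R * e) * (d'%:R * e')); first by ring.
by rewrite eE eE' !mulr1.
Qed.

End TwoSquaresMeadow.

(** * The positive part of [Q0i] and the isomorphism *)

Lemma rat_of_is_hom : is_hom rat_of.
Proof. exact/initial_hom_is_hom/rat_meadow_satisfies. Qed.

Lemma rat_of_inj : injective rat_of.
Proof.
apply: im_hom_inj rat_of_is_hom _; first exact: initial_algebra_satisfies.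
exact: closed_eval_repr.
Qed.

Local Notation Q0i_plus :=
  (@subalgebra Sigma_iamd (reduct imd_of_iamd Q0i) Q0i_pos Q0i_pos_closed).

Definition rat_of_pos (x : Q0i_plus) : reduct imd_of_iamd rat_meadow :=
  rat_of (sval x).

Lemma rat_of_pos_is_hom : is_hom rat_of_pos.
Proof. by move=> f a; rewrite /rat_of_pos /= rat_of_is_hom. Qed.

Lemma rat_of_pos_inj : injective rat_of_pos.
Proof. by move=> x y /rat_of_inj/val_inj. Qed.

Lemma rat_of_pos_gt0 x : 0 < (rat_of_pos x : rat).
Proof. exact: svalP x. Qed.

(** The equations are checked on rational values, which are positive and hence nonzero, as x x^-1 =
    1 requires. *)
Lemma Q0i_plus_satisfies : satisfies E_iamd Q0i_plus.
Proof.
apply: (satisfies_inj rat_of_pos_is_hom rat_of_pos_inj) => e Ee v.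
have : forall i, (rat_of_pos \o v) i != 0 :> rat.
  by move=> i; rewrite gt_eqF //; apply: rat_of_pos_gt0.
move: (rat_of_pos \o v) => w w_neq0; move: e Ee; rewrite /E_iamd.
do 7! [apply/forall_cons; split => /=; first by
  rewrite ?(addrA, mulrA, mulr1, mulrDr) ?divff //;
  (exact: addrC || exact: mulrC || idtac)].
by [].
Qed.

Theorem theorem1 :
  isomorphic Qia
    (@subalgebra Sigma_iamd (reduct imd_of_iamd Q0i) Q0i_pos Q0i_pos_closed).
Proof.
have hom_h := initial_hom_is_hom Q0i_plus_satisfies.
set h := @initial_hom _ _ _ in hom_h.
(* The composite into [rat] serves twice: its injectivity passes to [h], and its hitting every
   positive rational makes [h] surjective because [rat_of_pos] is injective. *)
have hom_k : is_hom (rat_of_pos \o h).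
  by move=> f a; rewrite /= hom_h rat_of_pos_is_hom.
have Qia_sat : satisfies E_iamd Qia := @initial_algebra_satisfies _ E_iamd.
have k_inj := am_hom_inj Qia_sat hom_k (@closed_eval_repr _ E_iamd).
have h_surj p : exists x, h x = p.
  have [x kx] := am_hom_surj hom_k (rat_of_pos_gt0 p).
  by exists x; apply: rat_of_pos_inj.
(* A chosen right inverse of [h] is also a left inverse, by injectivity. *)
have [g gK] := choice h_surj.
exists h => //; exists g => // x.
by apply: k_inj; rewrite /= gK.
Qed.
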